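(* Let $K\ge2$, $\mu\in\mathcal G^*$, $\mu'\in\mathcal G$ and $v\in\Sigma_K$. Then $$g(\mu',v)\ge\frac{(1-\eta)^2}{1+\eta}\Bigl(g(\mu,w(\mu))-\frac\varepsilon2\Bigr),$$ where $\varepsilon=\|\mu-\mu'\|_\infty$ and $\eta=\max_{1\le a\le K}\frac{|w_a(\mu)-v_a|}{w_a(\mu)}$.
   Context: $\mathcal G=[0,1]^K$ (mean vectors of $K$-armed Gaussian bandits with unit variance) and $\mathcal G^*\subset\mathcal G$ is the set of vectors whose maximal coordinate is attained at a unique index. $\Sigma_K=\{v\in[0,1]^K:\sum_av_a=1\}$. For $\mu\in\mathcal G$, let $a^*$ be an index of a maximal coordinate and $\Delta_a(\mu)=\mu_{a^*}-\mu_a$; for $v\in\Sigma_K$, $$g(\mu,v)=\frac12\min_{a\ne a^*}\frac{v_{a^*}v_a}{v_{a^*}+v_a}\Delta_a(\mu)^2$$ (with $\frac{0\cdot0}{0+0}=0$), so that $g(\mu,v)=0$ if $\mu$ has several maximal coordinates. For $\mu\in\mathcal G^*$, $w(\mu)$ is the unique maximizer of $v\mapsto g(\mu,v)$ over $\Sigma_K$; all its coordinates are positive.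
   Formalization: The bound is proved under the added assumption η ≤ 1; without it the claim fails for K ≥ 3, e.g. μ' = μ and v = e_a with a ≠ a* and w_a(μ) < 1/2, where g(μ',v) = 0 but the right-hand side is positive. *)

(* Defs.v *)
From HB Require Import structures.
From mathcomp Require Import all_boot all_order all_algebra.
From mathcomp Require Import all_classical all_reals all_analysis.

Set Implicit Arguments.
Unset Strict Implicit.
Unset Printing Implicit Defensive.

Import Order.TTheory GRing.Theory Num.Theory.
Import numFieldNormedType.Exports.

Local Open Scope classical_set_scope.
Local Open Scope ring_scope.

(* The number of arms is K = n.+2, so that K >= 2 holds by
   construction and both "argmax over all arms" and "min over the other arms"
   range over nonempty sets. *)
Section GaussianBandit.
Context {R : realType} {n : nat}.
Implicit Types mu v w : 'rV[R]_n.+2.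

Definition bandits : set 'rV[R]_n.+2 :=
  [set mu | forall a, 0 <= mu 0 a <= 1].

Definition bandits_star : set 'rV[R]_n.+2 :=
  [set mu | bandits mu /\
            exists! a : 'I_n.+2, forall b : 'I_n.+2, mu 0 b <= mu 0 a].

Definition simplex : set 'rV[R]_n.+2 :=
  [set v | (forall a, 0 <= v 0 a <= 1) /\ \sum_a v 0 a = 1].

(* When several arms are optimal, which one is selected is irrelevant: [g] then
   vanishes. *)
Definition best_arm mu : 'I_n.+2 := [arg max_(a > ord0) mu 0 a]%O.

Definition gap mu (a : 'I_n.+2) : R := mu 0 (best_arm mu) - mu 0 a.

(* The convention 0 * 0 / (0 + 0) = 0 is the library's [x / 0 = 0]. *)
Definition transport mu v (a : 'I_n.+2) : R :=
  v 0 (best_arm mu) * v 0 a / (v 0 (best_arm mu) + v 0 a) * gap mu a ^+ 2.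

(* [lift (best_arm mu) ord0] is itself an arm other than [best_arm mu]; used as
   the neutral value, it makes the iterated min the true min over these arms. *)
Definition g mu v : R :=
  2^-1 * \big[Num.min/transport mu v (lift (best_arm mu) ord0)]_(a < n.+2 |
            a != best_arm mu) transport mu v a.

(* For [mu] in [bandits_star] a maximizer exists and is unique, so the choice
   made by [xget] is no choice and the default value 0 is never used. *)
Definition opt_weights mu : 'rV[R]_n.+2 :=
  xget 0 [set w | simplex w /\ forall v, simplex v -> g mu v <= g mu w].

(* The terms are nonnegative, so the neutral value 0 does not affect the max.
   With eta = [rel_dist w v], lower bounds on [g] with the factor
   (1 - eta)^2 / (1 + eta) need eta <= 1, so that 0 <= 1 - eta <= v_a / w_a: for
   eta > 1 some v_a may vanish, making [g] zero, while the factor is positive. *)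
Definition rel_dist w v : R :=
  \big[Num.max/0]_(a < n.+2) (`|w 0 a - v 0 a| / w 0 a).

End GaussianBandit.

(* Main.v *)
(* If [g mu w <= 0] the bound is trivial; this also covers the case where the
   default value of [opt_weights] would be used, so no existence or uniqueness
   of the maximizer is needed.  Otherwise every [w_a] is positive and
   [(1 - eta) w_a <= v_a <= (1 + eta) w_a], so replacing [w] by [v] in
   [w_b w_a / (w_b + w_a)] costs at most the factor (1 - eta)^2 / (1 + eta).
   That quantity is at most 1/4, and squared gaps in [0, 1] move by at most
   4 eps, so each transport cost moves by at most eps.  If [mu] and [mu'] have
   different best arms, the best arm of [mu'] has gap at most 2 eps under [mu],
   and [g mu w - eps / 2 <= 0]. *)
Require Import Defs.
From HB Require Import structures.
From mathcomp Require Import all_boot all_order all_algebra.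
From mathcomp Require Import all_classical all_reals all_analysis.
From mathcomp Require Import ring lra.

Set Implicit Arguments.
Unset Strict Implicit.
Unset Printing Implicit Defensive.

Import Order.TTheory GRing.Theory Num.Theory.
Import numFieldNormedType.Exports.

Local Open Scope ring_scope.

Section ParallelSum.
Context {R : realFieldType}.
Implicit Types x y z t c d : R.

Definition parallel_sum x y := x * y / (x + y).

Lemma parallel_sum_ge0 x y : 0 <= x -> 0 <= y -> 0 <= parallel_sum x y.
Proof. by move=> x0 y0; rewrite divr_ge0 ?mulr_ge0 ?addr_ge0. Qed.

Lemma parallel_sum_le x y : 0 < x -> 0 < y -> parallel_sum x y <= (x + y) / 4.
Proof.
move=> x0 y0; rewrite ler_pdivrMr ?addr_gt0// -subr_ge0.
have := sqr_ge0 (x - y); lra.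
Qed.

(** The numerator [z * t] is at least [c ^+ 2 * (x * y)] and the denominator [z + t] is at most
    [d * (x + y)]. *)
Lemma parallel_sum_scale x y z t c d : 0 < x -> 0 < y -> 0 <= c -> 0 < d ->
  c * x <= z <= d * x -> c * y <= t <= d * y ->
  c ^+ 2 / d * parallel_sum x y <= parallel_sum z t.
Proof.
move=> x0 y0 c0 d0 /andP[cz zd] /andP[ct td].
have cx0 : 0 <= c * x by rewrite mulr_ge0 ?(ltW x0).
have cy0 : 0 <= c * y by rewrite mulr_ge0 ?(ltW y0).
have -> : c ^+ 2 / d * parallel_sum x y = (c * x) * (c * y) / (d * (x + y)).
  rewrite /parallel_sum; field; apply/andP; split; lra.
have : 0 <= z + t by rewrite addr_ge0 ?(le_trans _ cz) ?(le_trans _ ct).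
(* Inverting the denominators requires [0 < z + t]. If [z + t = 0], the nonnegative [c * x] and
   [c * y] both vanish, and so does the left side. *)
rewrite le_eqVlt => /predU1P[zt|zt].
  have z0 : c * x = 0 by lra.
  by rewrite z0 !mul0r parallel_sum_ge0 ?(le_trans _ cz) ?(le_trans _ ct).
apply: ler_pM; [exact: mulr_ge0 | | exact: ler_pM |].
  by rewrite invr_ge0 ltW// mulr_gt0 ?addr_gt0.
by rewrite lef_pV2 ?posrE ?(mulr_gt0 d0 (addr_gt0 x0 y0))// mulrDr lerD.
Qed.

End ParallelSum.

Section Bandits.
Context {R : realType} {n : nat}.
Implicit Types (mu nu v w : 'rV[R]_n.+2) (a b : 'I_n.+2).

Lemma best_arm_max mu a : mu 0 a <= mu 0 (best_arm mu).
Proof. by rewrite /best_arm; case: arg_maxP => // i _; apply. Qed.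

Lemma gap_bounds mu a : bandits mu -> 0 <= gap mu a <= 1.
Proof.
move=> hmu; rewrite subr_ge0 best_arm_max /=.
have /andP[_ b1] := hmu (best_arm mu); have /andP[a0 _] := hmu a.
rewrite /gap; lra.
Qed.

Lemma entry_dist mu nu a : `|mu 0 a - nu 0 a| <= `|mu - nu|.
Proof.
rewrite [leRHS]mx_normrE.
have := le_bigmax 0 (fun ij => `|(mu - nu) ij.1 ij.2|) (0, a).
by rewrite /= !mxE.
Qed.

Lemma transportE mu v a :
  transport mu v a = parallel_sum (v 0 (best_arm mu)) (v 0 a) * gap mu a ^+ 2.
Proof. by []. Qed.

Lemma transport_ge0 mu v a : (forall b, 0 <= v 0 b) -> 0 <= transport mu v a.
Proof. by move=> v0; rewrite transportE mulr_ge0 ?sqr_ge0 ?parallel_sum_ge0. Qed.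

Lemma g_ge mu v (x : R) :
  (forall a, a != best_arm mu -> x <= 2^-1 * transport mu v a) -> x <= g mu v.
Proof.
move=> h.
have h2 a : a != best_arm mu -> 2 * x <= transport mu v a.
  by move=> /h; lra.
suff : 2 * x <= 2 * g mu v by lra.
rewrite /g mulrA divff ?mul1r// le_bigmin//.
by rewrite h2// eq_sym neq_lift.
Qed.

Lemma g_le mu v a : a != best_arm mu -> g mu v <= 2^-1 * transport mu v a.
Proof. by move=> ab; rewrite /g ler_pM2l ?invr_gt0// bigmin_le_cond. Qed.

Lemma g_ge0 mu v : (forall b, 0 <= v 0 b) -> 0 <= g mu v.
Proof.
move=> v0; apply: g_ge => a _.
by rewrite mulr_ge0 ?invr_ge0 ?transport_ge0.
Qed.

Lemma opt_weights_ge0 mu a : 0 <= opt_weights mu 0 a.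
Proof.
rewrite /opt_weights; case: xgetP => [w _ [[/(_ a)/andP[]]]//|_].
by rewrite mxE.
Qed.

(** Both outcomes of [xget] obey this: a maximizer lies in the simplex, and the default is the zero
    vector. *)
Lemma opt_weights_le1 mu a b :
  a != b -> opt_weights mu 0 a + opt_weights mu 0 b <= 1.
Proof.
rewrite /opt_weights; case: xgetP => [w _ [[w01 w1] _] ab|_ _]; last first.
  by rewrite !mxE addr0.
rewrite -w1 (bigD1 a)//= (bigD1 b) 1?eq_sym//= addrA lerDl sumr_ge0// => i _.
by case/andP: (w01 i).
Qed.

(** A zero weight on the best arm would cancel every transport cost, and one on another arm would
    cancel its own; either way the minimum could not be positive. *)
Lemma g_gt0_weights mu w : (forall b, 0 <= w 0 b) -> 0 < g mu w ->
  forall a, 0 < w 0 a.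
Proof.
move=> w0 g0.
have aux a : a != best_arm mu -> 0 < w 0 a /\ 0 < w 0 (best_arm mu).
  move=> ab; have := lt_le_trans g0 (g_le w ab); rewrite transportE.
  rewrite !lt_neqAle !w0 !andbT => h.
  by split; apply/eqP => z; move: h; rewrite /parallel_sum -z !(mul0r, mulr0) eqxx.
move=> a; have [->|/aux[]//] := eqVneq a (best_arm mu).
by have [] := aux (lift (best_arm mu) ord0); rewrite // eq_sym neq_lift.
Qed.

Lemma rel_dist_ge0 w v : 0 <= rel_dist w v.
Proof. exact: bigmax_ge_id. Qed.

Lemma rel_dist_bounds w v a : 0 < w 0 a ->
  (1 - rel_dist w v) * w 0 a <= v 0 a <= (1 + rel_dist w v) * w 0 a.
Proof.
move=> w0.
have : `|w 0 a - v 0 a| / w 0 a <= rel_dist w v.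
  exact: (le_bigmax _ (fun a => `|w 0 a - v 0 a| / w 0 a)).
rewrite ler_pdivrMr// ler_norml => /andP[h1 h2].
apply/andP; split; lra.
Qed.

End Bandits.

Theorem proposition15 (R : realType) (n : nat) (mu mu' v : 'rV[R]_n.+2)
    (hmu : bandits_star mu) (hmu' : bandits mu') (hv : simplex v) :
  let w := opt_weights mu in
  let eps := `|mu - mu'| in
  let eta := rel_dist w v in
  eta <= 1 ->
  g mu' v >= (1 - eta) ^+ 2 / (1 + eta) * (g mu w - eps / 2).
Proof.
move=> w eps eta eta1.
have v0 a : 0 <= v 0 a by case/andP: (hv.1 a).
have w0 a : 0 <= w 0 a by exact: opt_weights_ge0.
have eta0 : 0 <= eta := rel_dist_ge0 w v.
have hB : bandits mu := hmu.1.
have c0 : 0 <= (1 - eta) ^+ 2 / (1 + eta) by rewrite divr_ge0 ?sqr_ge0 ?addr_ge0.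
have eps0 : 0 <= eps := normr_ge0 _.
have dist a : - eps <= mu 0 a - mu' 0 a <= eps.
  by rewrite -ler_norml entry_dist.
have nonpos_case : g mu w - eps / 2 <= 0 ->
    (1 - eta) ^+ 2 / (1 + eta) * (g mu w - eps / 2) <= g mu' v.
  by move=> h; apply: le_trans (g_ge0 _ v0); rewrite mulr_ge0_le0.
have [g0|g0] := leP (g mu w) 0; first by apply: nonpos_case; lra.
have wpos := g_gt0_weights w0 g0.
pose b := best_arm mu.
have small a : a != b -> 0 <= parallel_sum (w 0 b) (w 0 a) <= 4^-1.
  move=> ab; rewrite parallel_sum_ge0 //=.
  apply: (le_trans (parallel_sum_le (wpos _) (wpos _))).
  have := @opt_weights_le1 _ _ mu a b ab; rewrite -/w; lra.
have [bb'|bb'] := eqVneq (best_arm mu') b.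
  apply: g_ge => a; rewrite bb' => ab.
  have /andP[p0 p1] := small a ab.
  have /andP[d0 d1] := gap_bounds a hB.
  have /andP[d0' d1'] := gap_bounds a hmu'.
  have := g_le w ab; rewrite !transportE bb' -/b => gw.
  have gaps : gap mu a - gap mu' a <= 2 * eps.
    rewrite /gap bb' -/b; have := dist a; have := dist b; lra.
  (* Factor as a difference of squares: the gaps differ by at most [2 * eps] and sum to at most
     2. *)
  have sq : gap mu a ^+ 2 - gap mu' a ^+ 2 <= 4 * eps by nra.
  (* Taken with [c = 1 - eta] and [d = 1 + eta]; [eta1] gives [0 <= c]. *)
  have scale : (1 - eta) ^+ 2 / (1 + eta) * parallel_sum (w 0 b) (w 0 a)
      <= parallel_sum (v 0 b) (v 0 a).
    by apply: parallel_sum_scale; rewrite ?rel_dist_bounds ?subr_ge0 ?ltr_wpDr.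
  (* The loss is at most 1/2 * 1/4 * [4 * eps] = [eps / 2]. *)
  have cost : g mu w - eps / 2 <=
      2^-1 * (parallel_sum (w 0 b) (w 0 a) * gap mu' a ^+ 2) by nra.
  apply: (le_trans (ler_wpM2l c0 cost)).
  rewrite mulrCA ler_wpM2l// mulrA.
  by rewrite ler_wpM2r ?sqr_ge0.
apply: nonpos_case.
have /andP[p0 p1] := small _ bb'.
have /andP[d0 d1] := gap_bounds (best_arm mu') hB.
have := g_le w bb'; rewrite transportE -/b => gw.
(* [mu'] ranks its best arm at least as high as [b], and each of the two entries moves by at most
   [eps]. *)
have gap2 : gap mu (best_arm mu') <= 2 * eps.
  have := best_arm_max mu' b; rewrite /gap -/b.
  have := dist b; have := dist (best_arm mu'); lra.
(* A gap in [0, 1] dominates its square; hence [g mu w] is at most 1/2 * 1/4 * [2 * eps], below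
   [eps / 2]. *)
have sq : gap mu (best_arm mu') ^+ 2 <= 2 * eps by nra.
nra.
Qed.
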